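(* Let $N\ge 1$ and consider binary variables $x_1,\dots,x_N$ subject only to the box constraints $0\le x_i\le 1$ ($1\le i\le N$). Let $\mathrm{SA}(2)$ denote the level-2 Sherali–Adams relaxation of these box constraints, projected to the coordinates $(x,y)$ with $x=(x_i)_{1\le i\le N}$ and $y=(y_{ij})_{i\neq j}$. Then $$\mathrm{SA}(2)\ =\ \Big\{(x,y)\ \Big|\ 0\le x_i\le 1\ \ \forall i,\quad \max\{0,\,x_i+x_j-1\}\le y_{ij}\le \min\{x_i,x_j\}\ \ \forall i\neq j\Big\}.$$
   Context: Sherali–Adams relaxation. For a 0–1 feasibility set $\mathcal F=\{x\in\{0,1\}^N: Ax\le b\}$, the level-$k$ Sherali–Adams relaxation $\mathrm{SA}(k)$ is obtained as follows: (i) take each original inequality $a^\top x\le b$ together with the box constraints $x_i\ge 0$ and $1-x_i\ge 0$; (ii) multiply each of them by all products $\prod_{i\in U}x_i\prod_{j\in V}(1-x_j)$ with $U,V\subseteq\{1,\dots,N\}$, $U\cap V=\emptyset$, $|U|+|V|\le k-1$; (iii) linearize each resulting polynomial inequality by introducing a real variable for every monomial of degree at most $k$ and replacing products by those variables. $\mathrm{SA}(2)$ is the set of points satisfying all the resulting linear inequalities for $k=2$, in the coordinates of degree at most 2. Here there are no constraints $Ax\le b$ beyond the box constraints. The degree-1 variable of $x_i$ is again denoted $x_i$, and the variable of the monomial $x_ix_j$ ($i\ne j$) is denoted $y_{ij}$; since it is attached to the monomial, $y_{ij}=y_{ji}$ throughout (on both sides of the claimed equality). Because the variables are binary, $x_i^2$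 is identified with $x_i$ (that is, $y_{ii}=x_i$), and only the off-diagonal $y_{ij}$, $i\neq j$, are kept as coordinates. *)

(* Defs.v *)
From HB Require Import structures.
From mathcomp Require Import all_boot all_order all_algebra.
From mathcomp Require Import mpoly.

Set Implicit Arguments.
Unset Strict Implicit.
Unset Printing Implicit Defensive.

Import Order.TTheory GRing.Theory Num.Theory.
Local Open Scope ring_scope.

(* As x_i ^ 2 is identified with x_i, a monomial is determined by the set S of
   variables occurring in it, and its degree is #|S|. *)
Definition monomial_index (N k : nat) : Type :=
  {S : {set 'I_N} | (0 < #|S| <= k)%N}.

(* The constant monomial has value 1. The last branch (degree greater than k)
   never occurs in the inequalities of SA(k), whose polynomials have degree at
   most k. *)
Definition monomial_var (R : realFieldType) (N k : nat)
    (z : monomial_index N k -> R) (S : {set 'I_N}) : R :=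
  if S == set0 then 1 else if insub S is Some u then z u else 0.

Definition linearize (R : realFieldType) (N k : nat)
    (z : monomial_index N k -> R) (p : {mpoly R[N]}) : R :=
  \sum_(m <- msupp p) p@_m * monomial_var z [set i | m i != 0%N].

(* The polynomials p such that p >= 0 is one of the inequalities of the system
   A x <= b, 0 <= x_i, 0 <= 1 - x_i. *)
Variant base_ineq (R : realFieldType) (m N : nat)
    (A : 'M[R]_(m, N)) (b : 'cV[R]_m) : {mpoly R[N]} -> Prop :=
  | BaseRow (r : 'I_m) :
      base_ineq A b ((b r 0)%:MP - \sum_(i < N) (A r i) *: 'X_i)
  | BaseLower (i : 'I_N) : base_ineq A b 'X_i
  | BaseUpper (i : 'I_N) : base_ineq A b (1 - 'X_i).

Definition SheraliAdams (R : realFieldType) (m N : nat)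
    (A : 'M[R]_(m, N)) (b : 'cV[R]_m) (k : nat)
    (z : monomial_index N k -> R) : Prop :=
  forall (p : {mpoly R[N]}) (U V : {set 'I_N}),
    base_ineq A b p -> [disjoint U & V] -> (#|U| + #|V| < k)%N ->
    0 <= linearize z
           (p * (\prod_(i in U) 'X_i * \prod_(j in V) (1 - 'X_j))).

(* SA(2) of the box constraints alone (the system A x <= b has no row), in the
   coordinates x_i and y_ij with i != j; the diagonal of y is ignored. *)
Definition SA2_box (R : realFieldType) (N : nat)
    (x : 'rV[R]_N) (y : 'M[R]_N) : Prop :=
  exists z : monomial_index N 2 -> R,
    [/\ SheraliAdams (0 : 'M[R]_(0, N)) (0 : 'cV[R]_0) z,
        forall i : 'I_N, x 0 i = monomial_var z [set i]
      & forall i j : 'I_N, i != j -> y i j = monomial_var z [set i; j]].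

(* Main.v *)
(* A multiplier of SA(2) is 1, x_j or 1 - x_j, so the linearized system consists
   of 0 <= x_i <= 1 and of the linearizations of x_i x_j, x_i (1 - x_j) and
   (1 - x_i)(1 - x_j). For i != j the last three are the McCormick inequalities;
   for i = j, where the linearization of x_i ^ 2 is x_i, they only repeat
   0 <= x_i <= 1 or read 0 <= 0. *)
Require Import Defs.
From HB Require Import structures.
From mathcomp Require Import all_boot all_order all_algebra.
From mathcomp Require Import mpoly lra.

Set Implicit Arguments.
Unset Strict Implicit.
Unset Printing Implicit Defensive.

Import Order.TTheory GRing.Theory Num.Theory.
Local Open Scope ring_scope.

Section Linearize.
Variables (R : realFieldType) (N k : nat) (z : monomial_index N k -> R).

(** Monomials outside the support have coefficient 0. Since cancellation can make the supports of
    [p], [q] and [p - q] differ, additivity is proved by summing all three over one common list. *)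
Lemma linearize_wide (s : seq 'X_{1..N}) (p : {mpoly R[N]}) :
  uniq s -> {subset msupp p <= s} ->
  linearize z p = \sum_(m <- s) p@_m * monomial_var z [set i | m i != 0%N].
Proof.
move=> us sub; rewrite /linearize [RHS](bigID (mem (msupp p))) /=.
rewrite [X in _ + X]big1 ?addr0; last first.
  by move=> m /memN_msupp_eq0 ->; rewrite mul0r.
rewrite -[RHS]big_filter; apply: perm_big; apply: uniq_perm.
- exact: msupp_uniq.
- exact: filter_uniq.
- move=> m; rewrite mem_filter /=.
  by case: (boolP (m \in msupp p)) => //= /sub ->.
Qed.

Lemma linearizeB (p q : {mpoly R[N]}) :
  linearize z (p - q) = linearize z p - linearize z q.
Proof.
pose s := undup (msupp p ++ msupp q ++ msupp (p - q)).
have us : uniq s by exact: undup_uniq.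
rewrite !(@linearize_wide s) //; try by
  move=> m mp; rewrite mem_undup !mem_cat mp ?orbT.
by rewrite -sumrB; apply: eq_bigr => m _; rewrite mcoeffB mulrBl.
Qed.

Lemma linearizeXm (m : 'X_{1..N}) :
  linearize z 'X_[m] = monomial_var z [set i | m i != 0%N].
Proof. by rewrite /linearize msuppX big_seq1 mcoeffX eqxx mul1r. Qed.

Lemma linearize1 : linearize z 1 = 1.
Proof.
rewrite -mpolyX0 linearizeXm /monomial_var ifT //.
by apply/eqP/setP => i; rewrite !inE mnm0E.
Qed.

Lemma linearizeX (i : 'I_N) : linearize z 'X_i = monomial_var z [set i].
Proof.
rewrite linearizeXm; congr (monomial_var z _); apply/setP => l.
by rewrite !inE mnm1E (eq_sym i); case: (l == i).
Qed.

(** The case [i = j] is included: [[set i; i]] is [[set i]], so the identification of x_i ^ 2 with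
    x_i is built in. *)
Lemma linearizeXX (i j : 'I_N) :
  linearize z ('X_i * 'X_j) = monomial_var z [set i; j].
Proof.
rewrite -mpolyXD linearizeXm; congr (monomial_var z _); apply/setP => l.
by rewrite !inE mnmDE !mnm1E !(eq_sym _ l); case: (l == i); case: (l == j).
Qed.

Definition linearizeE := (linearizeB, linearize1, linearizeXX, linearizeX).

End Linearize.

Lemma cards_add_lt2 (T : finType) (U V : {set T}) :
  (#|U| + #|V| < 2)%N ->
  [\/ U = set0 /\ V = set0, exists2 j, U = [set j] & V = set0
    | exists2 j, U = set0 & V = [set j]].
Proof.
case EU: #|U| => [|[|n]]; case EV: #|V| => [|[|q]] // _.
- by move/cards0_eq: EU => ->; move/cards0_eq: EV => ->; constructor 1.
- move/cards0_eq: EU => ->; have /cards1P[j ->] : #|V| == 1%N by rewrite EV.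
  by constructor 3; exists j.
- move/cards0_eq: EV => ->; have /cards1P[j ->] : #|U| == 1%N by rewrite EU.
  by constructor 2; exists j.
Qed.

Lemma SheraliAdams2_boxP (R : realFieldType) (N : nat)
    (A : 'M[R]_(0, N)) (b : 'cV[R]_0) (z : monomial_index N 2 -> R) :
  let v := monomial_var z in
  SheraliAdams A b z <->
  (forall i, 0 <= v [set i] <= 1) /\
  (forall i j, [/\ 0 <= v [set i; j], v [set i; j] <= v [set i]
                 & v [set i] + v [set j] - 1 <= v [set i; j]]).
Proof.
move=> v; split=> [SA | [box mc] p U V].
  have mul1 p : base_ineq A b p -> 0 <= linearize z p.
    move=> pb; have := SA p set0 set0 pb;
    rewrite !big_set0 !mulr1 !cards0 disjoints_subset.
    by apply=> //; exact: sub0set.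
  have mulX p j : base_ineq A b p -> 0 <= linearize z (p * 'X_j).
    move=> pb; have := SA p [set j] set0 pb;
    rewrite big_set0 big_set1 mulr1 cards1 cards0.
    by apply=> //; rewrite disjoint_sym disjoints_subset sub0set.
  have mulBX p j : base_ineq A b p -> 0 <= linearize z (p * (1 - 'X_j)).
    move=> pb; have := SA p set0 [set j] pb;
    rewrite big_set0 big_set1 mul1r cards1 cards0.
    by apply=> //; rewrite disjoints_subset sub0set.
  split=> [i | i j].
    have := mul1 _ (BaseLower A b i); have := mul1 _ (BaseUpper A b i).
    by rewrite !linearizeE -/v => ? ?; apply/andP; split; lra.
  (* The products x_i x_j, x_i (1 - x_j) and (1 - x_i)(1 - x_j) yield the three bounds in the order
     of the goal. *)
  have := mulX _ j (BaseLower A b i); have := mulBX _ j (BaseLower A b i).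
  have := mulBX _ j (BaseUpper A b i).
  rewrite !(mulrBl, mulrBr, mulr1, mul1r) !linearizeE -/v => ? ? ?.
  by split; lra.
case=> [[]//|i|i] _ /cards_add_lt2[[-> ->]|[j -> ->]|[j -> ->]];
  rewrite ?big_set0 ?big_set1 !(mulrBl, mulrBr, mulr1, mul1r) !linearizeE -/v;
  have /andP[? ?] := box i; try (have [? ? ?] := mc i j); try lra.
(* What remains is (1 - x_i) x_j, which needs the upper bound by [v [set j]]: this is the second
   bound for the swapped pair. *)
by have [] := mc j i; rewrite setUC => *; lra.
Qed.

Section MonomialValues.
Variables (R : realFieldType) (N : nat) (x : 'rV[R]_N) (y : 'M[R]_N).

(** An index is an unordered set, so its elements are recovered by [pick]; which of two comes first
    is immaterial once [y] is symmetric off the diagonal. The value 0 is never reached, as an index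
    is nonempty. *)
Definition monomial_value (u : monomial_index N 2) : R :=
  if [pick i in val u] is Some i then
    if [pick j in val u :\ i] is Some j then y i j else x 0 i
  else 0.

Lemma monomial_value1 (i : 'I_N) : monomial_var monomial_value [set i] = x 0 i.
Proof.
rewrite /monomial_var -cards_eq0 cards1 /=.
case: insubP => [u _ eu|]; last by rewrite cards1.
rewrite /monomial_value eu; case: pickP => [a|/(_ i)]; last by rewrite !inE eqxx.
rewrite inE => /eqP ->; case: pickP => // c.
by rewrite !inE => /andP[/negbTE ->].
Qed.

Hypothesis ysym : forall i j, i != j -> y i j = y j i.

Lemma monomial_value2 (i j : 'I_N) :
  i != j -> monomial_var monomial_value [set i; j] = y i j.
Proof.
move=> ij; rewrite /monomial_var -cards_eq0 cards2 ij /=.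
case: insubP => [u _ eu|]; last by rewrite cards2 ij.
rewrite /monomial_value eu; case: pickP => [a|/(_ i)]; last by rewrite !inE eqxx.
rewrite !inE => /orP[]/eqP ->; case: pickP => [c|].
- by rewrite !inE => /andP[/negbTE ->] /= /eqP ->.
- by move/(_ j); rewrite !inE eqxx orbT eq_sym ij.
(* Here [pick] returned [j] first, so the value is [y j i] and symmetry is required. *)
- by rewrite !inE => /andP[/negbTE ->]; rewrite orbF => /eqP ->; apply/esym/ysym.
- by move/(_ i); rewrite !inE eqxx ij.
Qed.

End MonomialValues.

Theorem propositionB1 (R : realFieldType) (N : nat) (hN : (1 <= N)%N)
    (x : 'rV[R]_N) (y : 'M[R]_N)
    (ysym : forall i j : 'I_N, i != j -> y i j = y j i) :
  SA2_box x y <->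
  ((forall i : 'I_N, 0 <= x 0 i <= 1) /\
   (forall i j : 'I_N, i != j ->
      Num.max 0 (x 0 i + x 0 j - 1) <= y i j <= Num.min (x 0 i) (x 0 j))).
Proof.
split=> [[z [/SheraliAdams2_boxP[box mc] xE yE]] | [box mc]].
  split=> [i | i j ij]; first by rewrite xE.
  (* The swapped pair supplies the bound by x_j in the minimum. *)
  have [ij0 iji ijS] := mc i j; have [_ ijj _] := mc j i.
  by rewrite ge_max le_min !xE yE // ij0 iji ijS setUC ijj.
exists (monomial_value x y); split=> [|i|i j ij]; first last.
- by rewrite monomial_value2.
- by rewrite monomial_value1.
apply/SheraliAdams2_boxP; split=> [i|i j]; rewrite !monomial_value1 //.
(* On the diagonal the pair variable is x_i itself, and the bounds follow from 0 <= x_i <= 1; the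
   entries [y i i] are never read. *)
have [<-|ij] := eqVneq i j.
  by rewrite setUid monomial_value1; have /andP[? ?] := box i; split; lra.
rewrite monomial_value2 //; have := mc i j ij.
by rewrite ge_max le_min => /andP[/andP[? ?] /andP[? ?]].
Qed.
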